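(* Let $G$ be a bipartite simple graph with $V(G)=\{1,\dots,n\}$ and bipartition $(\{1,\dots,r\},\{r+1,\dots,n\})$. Let $s_i$ ($i=1,\dots,n$) and $a_e\le b_e$ ($e\in E(G)$) be integers. Then there exist integers $a_e\le x_e\le b_e$ ($e\in E(G)$) such that $\sum_{i=1}^n s_if_i=\sum_{e\in E(G)}x_e v(e)$ if and only if: (1) $s_1+\dots+s_r=s_{r+1}+\dots+s_n$; and (2) for all sets $I\subset\{1,\dots,r\}$, $J\subset\{r+1,\dots,n\}$ such that the induced subgraphs of $G$ on $I\cup J$ and on $(\{1,\dots,r\}\setminus I)\cup(\{r+1,\dots,n\}\setminus J)$ are connected, $$\sum_{i\in I}s_i-\sum_{j\in J}s_j\le\sum_{e=ij,\ i\in I,\ j\notin J}b_e-\sum_{e=ij,\ i\notin I,\ j\in J}a_e,$$ where in both sums $e=ij$ ranges over edges with $i\in\{1,\dots,r\}$, $j\in\{r+1,\dots,n\}$.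
   Context: $f_1,\dots,f_n$ is the standard basis of $\mathbb{Z}^n$ and for an edge $e=ij$, $v(e)=f_i+f_j$.
   Formalization: G is additionally assumed connected; without this the claim is false, e.g. n=4, r=2, edges 13 and 24, all a_e=b_e=0, s=(1,1,1,1): (1) and (2) hold but no x_e exist. *)

(* Defs.v *)
From mathcomp Require Import all_boot all_order all_algebra.

Set Implicit Arguments.
Unset Strict Implicit.
Unset Printing Implicit Defensive.

Import Order.TTheory GRing.Theory Num.Theory.

Local Open Scope ring_scope.

(* Vertices are 0, ..., n-1 rather than 1, ..., n, so that {1, ..., r} becomes
   [left_part n r] and {r+1, ..., n} becomes [right_part n r].
   A simple graph is its adjacency relation; its edges are 2-element sets. *)

Definition left_part (n r : nat) : {set 'I_n} := [set i : 'I_n | (i < r)%N].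
Definition right_part (n r : nat) : {set 'I_n} := [set i : 'I_n | (r <= i)%N].

Definition simple_graph (n : nat) (G : rel 'I_n) : Prop :=
  symmetric G /\ irreflexive G.

Definition has_bipartition (n : nat) (G : rel 'I_n) (L R : {set 'I_n}) : Prop :=
  forall i j : 'I_n, G i j ->
    (i \in L /\ j \in R) \/ (i \in R /\ j \in L).

Definition edges (n : nat) (G : rel 'I_n) : {set {set 'I_n}} :=
  [set [set i; j] | i in 'I_n, j in 'I_n & G i j].

Definition std_basis (n : nat) (i : 'I_n) : 'rV[int]_n := delta_mx 0 i.

(* Equals f_i + f_j when e = [set i; j] with i != j. *)
Definition edge_vec (n : nat) (e : {set 'I_n}) : 'rV[int]_n :=
  \sum_(i in e) std_basis i.

Definition induced (n : nat) (G : rel 'I_n) (A : {set 'I_n}) : rel 'I_n :=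
  [rel i j | [&& i \in A, j \in A & G i j]].

(* With this convention the subgraph induced on set0 is connected. *)
Definition connected_on (n : nat) (G : rel 'I_n) (A : {set 'I_n}) : Prop :=
  {in A &, forall i j, connect (induced G A) i j}.

Definition connected_graph (n : nat) (G : rel 'I_n) : Prop :=
  connected_on G [set: 'I_n].

(* Main.v *)
Require Import Defs.
From mathcomp Require Import all_boot all_order all_algebra.
From mathcomp Require Import zify ring.

Import Order.TTheory GRing.Theory Num.Theory.

Local Open Scope ring_scope.

(** Orienting every edge from left to right turns the [x_e] into an integral
    flow with bounds [a_e <= x_e <= b_e] and net outflow [s_i] on the left,
    [- s_j] on the right. By Hoffman's circulation theorem (augmenting paths: the
    set reachable in the residual graph from a vertex with positive excess either
    contains a vertex with negative excess or is a violated cut) such a flow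
    exists iff the total supply is zero and every cut [S] has nonnegative slack.
    The slack is additive over vertex sets with no edge between them, and
    complementing a cut only reverses the flow. Splitting first [S] and then the
    complement of each piece of [S] into components reduces all cuts to those
    with both sides connected, connectedness of [G] keeping the other side of
    each such piece connected. *)

(** * Flows under skew-symmetric encoding and Hoffman's circulation theorem *)

Section SkewFlow.
Context {V : finType}.
Implicit Types (k y : V -> V -> int) (d : V -> int) (S T : {set V}).

(** Capacity of the arcs leaving [S] minus the net outflow that [d] demands of [S]; Hoffman's
    condition is that it is never negative. *)
Definition cut_slack k d S : int :=
  \sum_(u in S) (\sum_(w in ~: S) k u w - d u).

(* A flow [x] on arcs is encoded by [y u w = x u w - x w u]. The single bound
   [y <= k] contains lower bounds too, as [- k w u <= y u w] by skew symmetry. *)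
Definition skew_flow k y : Prop :=
  (forall u w, y u w = - y w u) /\ (forall u w, y u w <= k u w).

Lemma sum_skew y S : (forall u w, y u w = - y w u) ->
  \sum_(u in S) \sum_(w in S) y u w = 0.
Proof.
move=> sk; set t := LHS.
suff: t = - t by lia.
rewrite {1}/t exchange_big /= /t -sumrN; apply: eq_bigr => u _.
by rewrite -sumrN; apply: eq_bigr => w _.
Qed.

Lemma skew_flow_sum k d y : skew_flow k y -> (forall u, \sum_w y u w = d u) ->
  \sum_u d u = 0.
Proof.
move=> [sk _] yd; under eq_bigr do rewrite -yd.
apply: etrans (sum_skew y setT sk).
by apply: eq_big => [u|u _]; [rewrite inE | apply: eq_bigl => w; rewrite inE].
Qed.

(** Flow between two vertices of [S] cancels against its reverse, so only the flow leaving [S]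
    counts. *)
Lemma sum_skew_out y d S : (forall u w, y u w = - y w u) ->
  \sum_(u in S) (\sum_(w in ~: S) y u w - d u)
  = \sum_(u in S) (\sum_w y u w - d u).
Proof.
move=> sk; rewrite !sumrB; congr (_ - _).
under [RHS]eq_bigr => u _ do rewrite (bigID (mem S)) /=.
rewrite big_split /= sum_skew // add0r.
by apply: eq_bigr => u _; apply: eq_bigl => w; rewrite inE.
Qed.

Lemma skew_flow_cut k d y S : skew_flow k y ->
  (forall u, \sum_w y u w = d u) -> 0 <= cut_slack k d S.
Proof.
move=> [sk yk] yd.
(* The slack computed with [y] in place of [k] vanishes, and [y <= k] makes it a lower bound. *)
have <- : \sum_(u in S) (\sum_(w in ~: S) y u w - d u) = 0.
  by rewrite sum_skew_out // big1 // => u _; rewrite yd subrr.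
by apply: ler_sum => u _; rewrite lerD2r; apply: ler_sum.
Qed.

(** By skew symmetry this one inequality covers both ways to push a unit from [u] to [w]: more flow
    forwards or less flow backwards. *)
Definition residual k y : rel V := fun u w => y u w < k u w.

(** One unit is pushed along the tail of the path first. The clause on vertices off the path then
    shows that the first arc is still residual, because [u] does not recur in the tail. *)
Lemma augment k y u p : skew_flow k y -> path (residual k y) u p ->
  uniq (u :: p) ->
  exists y', [/\ skew_flow k y',
    forall v w, v \notin u :: p -> y' v w = y v w
  & forall v, \sum_w y' v w
      = \sum_w y v w + (v == u)%:R - (v == last u p)%:R].
Proof.
move=> fy; elim: p u => [|w p IHp] u /=.
  by move=> _ _; exists y; split=> // v; rewrite addrK.
move=> /andP[ruw pp] /andP[uNp up].
have [y' [[sk' yk'] loc sum']] := IHp w pp up.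
have uw : u != w by apply: contraNneq uNp => ->; rewrite mem_head.
(* [dl P Q] is the indicator of the arc from [P] to [Q]; adding it and subtracting that of the
   reversed arc preserves skew symmetry. *)
pose dl (P Q p q : V) : int := ((p == P) && (q == Q))%:R.
exists (fun p q => y' p q + dl u w p q - dl w u p q); split.
- split=> [v q|v q].
    by rewrite /dl (sk' v q) [(q == u) && _]andbC [(q == w) && _]andbC; lia.
  have := yk' v q; rewrite /dl.
  have [/andP[/eqP-> /eqP->]|_] := boolP ((v == u) && (q == w)).
    by move: ruw; rewrite /residual loc //; case: (_ && _); lia.
  by case: (_ && _); lia.
- move=> v q; rewrite inE negb_or => /andP[vu vp].
  rewrite loc // /dl (negbTE vu) /=.
  move: vp; rewrite inE negb_or => /andP[/negbTE-> _] /=; lia.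
- have sdl P Q v : \sum_q dl P Q v q = (v == P)%:R.
    rewrite /dl; case: eqP => _ /=; last by rewrite big1.
    rewrite (bigD1 Q) //= eqxx big1 ?addr0 // => q /negbTE->//.
  move=> v; rewrite sumrB big_split /= !sdl sum'; ring.
Qed.

(** The enumeration of [V] orients each pair, and the arc towards the higher rank is saturated. The
    hypothesis is then the bound on the reversed arc and, for [u = w], the bound at the diagonal
    value 0. *)
Lemma skew_flow0 k : (forall u w, 0 <= k u w + k w u) ->
  exists y, skew_flow k y.
Proof.
move=> k0; exists (fun u w => if (enum_rank u < enum_rank w)%N then k u w
  else if (enum_rank w < enum_rank u)%N then - k w u else 0); split=> u w.
  by case: ltngtP; rewrite ?opprK ?oppr0.
case: ltngtP => // [_|/ord_inj/enum_rank_inj <-].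
  by have := k0 u w; lia.
by have := k0 u u; lia.
Qed.

Lemma hoffman_circulation k d : (forall u w, 0 <= k u w + k w u) ->
  \sum_u d u = 0 -> (forall S, 0 <= cut_slack k d S) ->
  exists y, skew_flow k y /\ forall u, \sum_w y u w = d u.
Proof.
move=> k0 d0 cut0; have [y fy] := skew_flow0 k k0.
pose ex y u := d u - \sum_w y u w.
(* Induction on the total absolute excess, where [ex] is the demanded outflow still missing: an
   augmentation from a positive to a negative excess strictly lowers it. *)
have [m] := ubnP (\sum_u `|ex y u|)%N.
elim: m y fy => // m IHm y fy ltm.
have [all0|] := boolP [forall u, ex y u == 0].
  exists y; split=> // u; move/forallP/(_ u): all0; rewrite /ex; lia.
rewrite negb_forall => /existsP[z zN0].
have sum_ex : \sum_u ex y u = 0.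
  rewrite sumrB d0 sub0r (@skew_flow_sum k (fun u => \sum_w y u w) y) //.
have [u u_pos] : exists u, 0 < ex y u.
  apply/existsP; apply: contraT; rewrite negb_exists => /forallP le0.
  have /eqP := sum_ex; rewrite -oppr_eq0 -sumrN psumr_eq0 => [|v _].
    move/allP/(_ z (mem_index_enum _)); rewrite oppr_eq0 /= => ez.
    by rewrite ez in zN0.
  by have := le0 v; lia.
pose S := [set w | connect (residual k y) u w].
have [/existsP[t /andP[]]|] := boolP [exists t, (t \in S) && (ex y t < 0)].
  rewrite inE => /connectP[q0 pq0 ->] {t}.
  case/shortenP: pq0 => q pq uq _ t_neg.
  have [y' [fy' _ sum']] := augment k y u q fy pq uq.
  apply: (IHm y' fy'); move: ltm; rewrite ltnS; apply: leq_trans.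
  set t := last u q in t_neg sum' *.
  have ut : u != t by apply: contraTneq t_neg => <-; lia.
  have ex' v : ex y' v = ex y v - (v == u)%:R + (v == t)%:R.
    by rewrite /ex sum'; lia.
  rewrite (bigD1 u) //= [X in (_ <= X)%N](bigD1 u) //= -addSn.
  apply: leq_add.
    by rewrite ex' eqxx (negbTE ut); lia.
  apply: leq_sum => v /negbTE vu; rewrite ex' vu.
  by case: eqP => [->|_]; lia.
rewrite negb_exists => /forallP noneg.
have uS : u \in S by rewrite inE connect0.
have : 0 < \sum_(v in S) ex y v.
  rewrite (bigD1 u) //= ltr_wpDr // sumr_ge0 // => v /andP[vS _].
  by have := noneg v; rewrite vS; lia.
(* Arcs leaving [S] are saturated, as a residual one would lead to a vertex of [S]. So the slack of
   [S] is minus its total excess, hence negative. *)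
suff -> : \sum_(v in S) ex y v = - cut_slack k d S.
  by have := cut0 S; lia.
have -> : cut_slack k d S = \sum_(v in S) (\sum_(w in ~: S) y v w - d v).
  apply: eq_bigr => v vS; congr (_ - _); apply: eq_bigr => w.
  rewrite inE => wS; apply/eqP; rewrite eq_le (fy.2 v w) andbT leNgt.
  apply: contra wS => rvw; rewrite !inE in vS *.
  exact: connect_trans vS (connect1 rvw).
rewrite sum_skew_out ?fy.1 //; last exact: fy.1.
by rewrite -sumrN; apply: eq_bigr => v _; rewrite opprB.
Qed.

(** * Slack of unions and complements *)

Lemma cut_slackU k d S T : [disjoint S & T] ->
  {in S & T, forall u w, k u w = 0 /\ k w u = 0} ->
  cut_slack k d (S :|: T) = cut_slack k d S + cut_slack k d T.
Proof.
move=> dST k0; rewrite /cut_slack (eq_bigl [predU S & T]) => [|u]; last first.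
  by rewrite inE.
rewrite bigU //=.
have aux (A B : {set V}) u : [disjoint A & B] -> {in B, forall w, k u w = 0} ->
    \sum_(w in ~: (A :|: B)) k u w = \sum_(w in ~: A) k u w.
  move=> dAB kB; rewrite [RHS](bigID (mem B)) /= [X in X + _]big1 ?add0r.
    by apply: eq_bigl => w; rewrite !inE negb_or.
  by move=> w /andP[_ /kB].
congr (_ + _); apply: eq_bigr => u uS; congr (_ - _).
  by apply: aux => // w wT; case: (k0 u w uS wT).
rewrite setUC; apply: aux; first by rewrite disjoint_sym.
by move=> w wT; case: (k0 w u wT uS).
Qed.

(** Arcs leaving [~: S] are the reversed arcs leaving [S], and zero total supply negates the demand.
    This gives access to additivity on the complement side. *)
Lemma cut_slackC k d S : \sum_u d u = 0 ->
  cut_slack k d (~: S) = cut_slack (fun u w => k w u) (fun u => - d u) S.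
Proof.
move=> d0; rewrite /cut_slack !sumrB setCK exchange_big /=; congr (_ - _).
rewrite sumrN; apply/eqP; rewrite -addr_eq0 addrC -[X in _ == X]d0.
rewrite [X in _ == X](bigID (mem S)) /=; apply/eqP; congr (_ + _).
by apply: eq_bigl => u; rewrite inE.
Qed.

End SkewFlow.

(** * Reduction to cuts with both sides connected *)

Section Reduction.
Context {n : nat} (G : rel 'I_n) (symG : symmetric G).
Implicit Types S T A C : {set 'I_n}.

Lemma connect_induced_sym A : connect_sym (induced G A).
Proof. by apply: sym_connect_sym => i j; rewrite /induced /= symG andbCA. Qed.

Lemma connect_inducedS A C i j : A \subset C ->
  connect (induced G A) i j -> connect (induced G C) i j.
Proof.
move=> sAC; apply: connect_sub => u w /= /and3P[uA wA Guw].
by apply: connect1; rewrite /induced /= !(subsetP sAC) // Guw.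
Qed.

(** If some vertex of [A] fails to reach another inside [A], its component and the rest of [A] are
    the two pieces. *)
Lemma connected_or_split A : connected_on G A \/
  exists A1 A2, [/\ A1 != set0, A2 != set0, [disjoint A1 & A2], A = A1 :|: A2
    & {in A1 & A2, forall u w, ~~ G u w}].
Proof.
have [/forallP conA|] := boolP [forall i, forall j,
    (i \in A) && (j \in A) ==> connect (induced G A) i j].
  left=> i j iA jA; have /forallP/(_ j) := conA i.
  by rewrite iA jA.
rewrite negb_forall => /existsP[i]; rewrite negb_forall => /existsP[j].
rewrite negb_imply => /andP[/andP[iA jA] nij]; right.
pose B := [set w in A | connect (induced G A) i w].
exists B, (A :\: B); split.
- by apply/set0Pn; exists i; rewrite !inE iA connect0.
- by apply/set0Pn; exists j; rewrite !inE jA (negbTE nij).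
- rewrite -setI_eq0; apply/eqP/setP=> w.
  by rewrite !inE; case: (_ \in A); case: (connect _ _ _).
- by apply/setP=> w; rewrite !inE; case: (_ \in A); case: (connect _ _ _).
- move=> u w; rewrite !inE => /andP[uA iu] /andP[].
  rewrite negb_and => niw wA; rewrite wA /= in niw.
  apply: contra niw => Guw; apply: connect_trans iu (connect1 _).
  by rewrite /induced /= uA wA.
Qed.

(** Outside itself, [T] has neighbours only in [C]. A path of [G] from outside [T] to [c0] therefore
    meets [C] before it can enter [T], and from there [c0] is reached inside [C]. *)
Lemma connected_on_compl C T : connected_graph G -> connected_on G C ->
  C != set0 -> [disjoint C & T] ->
  {in T & ~: (C :|: T), forall u w, ~~ G u w} -> connected_on G (~: T).
Proof.
move=> conG conC /set0Pn[c0 c0C] dCT noT.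
have sCT : C \subset ~: T by rewrite -disjoints_subset.
suff to_c0 u : u \in ~: T -> connect (induced G (~: T)) u c0.
  move=> u w uT wT; apply: connect_trans (to_c0 u uT) _.
  by rewrite connect_induced_sym to_c0.
have := conG u c0 (in_setT _) (in_setT _); case/connectP=> p.
elim: p u => [|w p IHp] u /=; first by move=> _ -> _; apply: connect0.
move=> /andP[/and3P[_ _ Guw] pp] lp uT.
have [uC|uNC] := boolP (u \in C).
  exact: connect_inducedS sCT (conC _ _ uC c0C).
have wT : w \in ~: T.
  rewrite inE; apply: contraL Guw => wT; rewrite symG; apply: noT => //.
  by rewrite !inE (negbTE uNC) /=; rewrite inE in uT.
apply: connect_trans (IHp w pp lp wT).
by apply: connect1; rewrite /induced /= uT wT.
Qed.

Lemma cut_slack_connected (k : 'I_n -> 'I_n -> int) (d : 'I_n -> int) :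
  connected_graph G -> (forall u w, ~~ G u w -> k u w = 0) ->
  \sum_u d u = 0 ->
  (forall S, connected_on G S -> connected_on G (~: S) ->
     0 <= cut_slack k d S) ->
  forall S, 0 <= cut_slack k d S.
Proof.
move=> conG kG d0 conn_ge0.
have k0 (A B : {set 'I_n}) : {in A & B, forall u w, ~~ G u w} ->
    {in A & B, forall u w, k u w = 0 /\ k w u = 0}.
  by move=> AB u w uA wB; have := AB u w uA wB; split; apply: kG; rewrite // symG.
(* Here [T] is a union of components of [G] minus [C], a property that both pieces inherit when [T]
   is split. *)
have co_ge0 C T : connected_on G C -> C != set0 -> [disjoint C & T] ->
    {in T & ~: (C :|: T), forall u w, ~~ G u w} -> 0 <= cut_slack k d (~: T).
  move=> conC C0; have [m] := ubnP #|T|.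
  elim: m T => // m IHm T ltm dCT noT.
  have [conT|[T1 [T2 [T1_0 T2_0 d12 eqT no12]]]] := connected_or_split T.
    by apply: conn_ge0; rewrite ?setCK //; apply: connected_on_compl noT.
  have cardT : #|T| = (#|T1| + #|T2|)%N.
    by rewrite eqT cardsU disjoint_setI0 // cards0 subn0.
  rewrite -!card_gt0 in T1_0 T2_0.
  have dC1 : [disjoint C & T1] by apply: disjointWr dCT; rewrite eqT subsetUl.
  have dC2 : [disjoint C & T2] by apply: disjointWr dCT; rewrite eqT subsetUr.
  rewrite eqT.
  (* Complementing passes to [T1 :|: T2], where the slack is additive; each summand is then
     complemented back. *)
  rewrite cut_slackC // cut_slackU //; last first.
    by move=> u w u1 w2; case: (k0 T1 T2 no12 u w u1 w2).
  rewrite -!cut_slackC //; apply: addr_ge0; apply: IHm => //.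
  - lia.
  - move=> u w u1; rewrite !inE negb_or => /andP[wC w1].
    have [w2|w2] := boolP (w \in T2); first exact: no12.
    by apply: noT; rewrite eqT !inE ?u1 // !negb_or wC w1.
  - lia.
  - move=> u w u2; rewrite !inE negb_or => /andP[wC w2].
    have [w1|w1] := boolP (w \in T1); first by rewrite symG; apply: no12.
    by apply: noT; rewrite eqT !inE ?u2 ?orbT // !negb_or wC w1.
move=> S; have [m] := ubnP #|S|.
elim: m S => // m IHm S ltm.
have [conS|[S1 [S2 [S1_0 S2_0 d12 eqS no12]]]] := connected_or_split S.
  have [->|S0] := eqVneq S set0; first by rewrite /cut_slack big_set0.
  (* With [C = S] and [T = ~: S] nothing lies outside [C :|: T], so the condition on edges is
     vacuous. *)
  rewrite -[S]setCK; apply: co_ge0 conS S0 _ _.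
    by rewrite -setI_eq0 setICr.
  by move=> u w _; rewrite setUCr !inE.
have cardS : #|S| = (#|S1| + #|S2|)%N.
  by rewrite eqS cardsU disjoint_setI0 // cards0 subn0.
rewrite -!card_gt0 in S1_0 S2_0.
by rewrite eqS cut_slackU //; [apply: addr_ge0; apply: IHm; lia | apply: k0].
Qed.

End Reduction.

(** * From the vector identity to one equation per vertex *)

Lemma edge_vecE n (e : {set 'I_n}) v : edge_vec e 0 v = (v \in e)%:R.
Proof.
rewrite /edge_vec summxE; under eq_bigr do rewrite mxE /=.
have [ve|ve] := boolP (v \in e).
  rewrite (bigD1 v) //= eqxx big1 ?addr0 // => i /andP[_].
  by rewrite eq_sym => /negbTE->.
by rewrite big1 // => i ie; case: eqP ie ve => // -> ->.
Qed.

(** Sending [w] to [[set v; w]] is a bijection from the neighbours of [v] to the edges at [v];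
    injectivity rests on the absence of loops. *)
Lemma sum_incident n (G : rel 'I_n) (F : {set 'I_n} -> int) v :
  simple_graph G ->
  \sum_(e in edges G | v \in e) F e = \sum_(w | G v w) F [set v; w].
Proof.
move=> [symG irrG].
pose nb := [set w | G v w].
have neq w : w \in nb -> v != w.
  by rewrite inE; apply: contraTneq => <-; rewrite irrG.
have inj : {in nb &, injective (fun w => [set v; w])}.
  move=> w w' wn w'n /setP/(_ w); rewrite !inE eqxx orbT eq_sym.
  by rewrite (negbTE (neq w wn)) => /esym/eqP.
have -> : \sum_(w | G v w) F [set v; w] = \sum_(w in nb) F [set v; w].
  by apply: eq_bigl => w; rewrite inE.
rewrite -(big_imset _ inj) /=; apply: eq_bigl => e; apply/andP/imsetP.
  case=> /imset2P[i j _]; rewrite inE => /andP[_ Gij] -> /set2P[] vE.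
    by exists j; rewrite ?inE vE.
  by exists i; rewrite ?inE vE 1?symG // setUC.
case=> w; rewrite inE => Gvw ->; rewrite !inE eqxx; split=> //.
by apply/imset2P; exists v w; rewrite ?inE.
Qed.

Lemma std_decompositionP n (G : rel 'I_n) (s : 'I_n -> int)
    (x : {set 'I_n} -> int) : simple_graph G ->
  \sum_(i < n) s i *: std_basis i = \sum_(e in edges G) x e *: edge_vec e
  <-> forall v, s v = \sum_(w | G v w) x [set v; w].
Proof.
move=> simG.
have lhs v : (\sum_(i < n) s i *: std_basis i) 0 v = s v.
  rewrite summxE (bigD1 v) //= !mxE !eqxx mulr1 big1 ?addr0 // => i.
  by rewrite !mxE /= eq_sym => /negbTE->; rewrite mulr0.
have rhs v : (\sum_(e in edges G) x e *: edge_vec e) 0 v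
    = \sum_(w | G v w) x [set v; w].
  rewrite -sum_incident // summxE (bigID (fun e : {set 'I_n} => v \in e)) /=.
  rewrite [X in _ + X]big1 => [|e /andP[_ /negbTE ve]].
    by rewrite addr0; apply: eq_bigr => e /andP[_ ve]; rewrite mxE edge_vecE ve mulr1.
  by rewrite mxE edge_vecE ve mulr0.
split=> [/matrixP eqs v|eqs]; first by rewrite -lhs eqs rhs.
by apply/matrixP=> i v; rewrite ord1 lhs rhs.
Qed.

(** * Bipartite graphs as networks directed from left to right *)

Section Bipartite.
Context {n r : nat} (G : rel 'I_n) (s : 'I_n -> int) (a b : {set 'I_n} -> int).
Hypotheses (simpleG : simple_graph G)
  (bipG : has_bipartition G (left_part n r) (right_part n r)).
Implicit Types I J S : {set 'I_n}.

Local Notation L := (left_part n r).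
Local Notation R := (right_part n r).

(** Two edge functions are taken because reversing an arc turns a lower bound into a negated upper
    bound: [orient b a] is the capacity and [orient x x] the flow. *)
Definition orient (f g : {set 'I_n} -> int) (u w : 'I_n) : int :=
  if G u w then if u \in L then f [set u; w] else - g [set u; w] else 0.

Definition signed (v : 'I_n) : int := if v \in L then s v else - s v.

Lemma right_partE v : (v \in R) = (v \notin L).
Proof. by rewrite !inE leqNgt. Qed.

Lemma adj_left u w : G u w -> (w \in L) = (u \notin L).
Proof.
by move=> /bipG; rewrite !right_partE => -[[-> /negbTE->]|[-> ->]].
Qed.

Lemma orient_left f g u w : u \in L -> G u w -> orient f g u w = f [set u; w].
Proof. by rewrite /orient => -> ->. Qed.

Lemma orient_right f g u w : u \notin L -> G u w ->
  orient f g u w = - g [set u; w].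
Proof. by rewrite /orient => /negbTE-> ->. Qed.

(** For [f = g] this is skew symmetry of the flow; for the bounds it compares the capacity of an arc
    with that of its reverse. *)
Lemma orient_swap f g u w : orient f g u w = - orient g f w u.
Proof.
have [symG _] := simpleG.
rewrite /orient symG; case: (boolP (G w u)) => [Gwu|]; last by rewrite oppr0.
by rewrite (adj_left _ _ Gwu) setUC; case: (w \in L); rewrite //= opprK.
Qed.

Lemma sum_orient x v : \sum_w orient x x v w
  = if v \in L then \sum_(w | G v w) x [set v; w]
    else - \sum_(w | G v w) x [set v; w].
Proof.
rewrite /orient -big_mkcond /=.
by case: (v \in L) => //; rewrite sumrN.
Qed.

Lemma sum_signed : \sum_u signed u = \sum_(i in L) s i - \sum_(j in R) s j.
Proof.
rewrite (bigID (mem L)) /= -sumrN; congr (_ + _).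
  by apply: eq_bigr => u uL; rewrite /signed uL.
apply: eq_big => [u|u /negbTE uL]; first by rewrite right_partE.
by rewrite /signed uL.
Qed.

(** Arcs leaving [I :|: J] run either from [I] to [R :\: J], with capacity [b], or from [J] to
    [L :\: I], with capacity [- a]. *)
Lemma bipartite_cut_slack I J : I \subset L -> J \subset R ->
  cut_slack (orient b a) signed (I :|: J)
  = \sum_(i in I) \sum_(j in R :\: J | G i j) b [set i; j]
    - \sum_(i in L :\: I) \sum_(j in J | G i j) a [set i; j]
    - (\sum_(i in I) s i - \sum_(j in J) s j).
Proof.
move=> /subsetP IL /subsetP JR; have [symG _] := simpleG.
have dIJ : [disjoint I & J].
  rewrite disjoint_subset; apply/subsetP => u /IL uL.
  by rewrite inE; apply: contraL uL => /JR; rewrite right_partE.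
rewrite /cut_slack (eq_bigl [predU I & J]) => [|u]; last by rewrite inE.
rewrite bigU //= !sumrB.
have -> : \sum_(i in I) \sum_(w in ~: (I :|: J)) orient b a i w
    = \sum_(i in I) \sum_(j in R :\: J | G i j) b [set i; j].
  apply: eq_bigr => i /IL iL; rewrite big_mkcond [RHS]big_mkcond /=.
  apply: eq_bigr => w _; rewrite in_setC in_setU in_setD right_partE.
  have [Giw|/negbTE Giw] := boolP (G i w); last first.
    by rewrite andbF /orient Giw if_same.
  have wL := adj_left _ _ Giw; rewrite iL /= in wL.
  have -> : (w \in I) = false by apply: contraFF wL => /IL.
  by rewrite wL orient_left //= !andbT.
have -> : \sum_(j in J) \sum_(w in ~: (I :|: J)) orient b a j w
    = - \sum_(i in L :\: I) \sum_(j in J | G i j) a [set i; j].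
  rewrite [X in - X](exchange_big_dep (mem J)) /=; last by move=> ? ? _ /andP[].
  rewrite -sumrN; apply: eq_bigr => j jJ.
  have jL : j \notin L by rewrite -right_partE JR.
  rewrite -sumrN big_mkcond [RHS]big_mkcond /=; apply: eq_bigr => w _.
  rewrite in_setC in_setU in_setD jJ symG /=.
  have [Gjw|/negbTE Gjw] := boolP (G j w); last first.
    by rewrite andbF /orient Gjw if_same.
  have wL := adj_left _ _ Gjw; rewrite jL in wL.
  have -> : (w \in J) = false.
    by apply: contraTF wL => /JR; rewrite right_partE.
  by rewrite wL orient_right //= orbF !andbT setUC.
have -> : \sum_(i in I) signed i = \sum_(i in I) s i.
  by apply: eq_bigr => i /IL iL; rewrite /signed iL.
have -> : \sum_(j in J) signed j = - \sum_(j in J) s j.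
  rewrite -sumrN; apply: eq_bigr => j /JR.
  by rewrite right_partE /signed => /negbTE->.
ring.
Qed.

(** Cuts [S] correspond to pairs [(I, J)] through [S :&: L] and [S :&: R]. *)
Lemma bipartite_cut_slackP :
  (forall S, connected_on G S -> connected_on G (~: S) ->
     0 <= cut_slack (orient b a) signed S) <->
  (forall I J, I \subset L -> J \subset R ->
     connected_on G (I :|: J) -> connected_on G ((L :\: I) :|: (R :\: J)) ->
     \sum_(i in I) s i - \sum_(j in J) s j
     <= \sum_(i in I) \sum_(j in R :\: J | G i j) b [set i; j]
        - \sum_(i in L :\: I) \sum_(j in J | G i j) a [set i; j]).
Proof.
have compl I J : I \subset L -> J \subset R ->
    (L :\: I) :|: (R :\: J) = ~: (I :|: J).
  move=> /subsetP IL /subsetP JR; apply/setP=> u.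
  rewrite in_setU !in_setD in_setC in_setU right_partE negb_or.
  have [uL|uL] := boolP (u \in L); rewrite /= ?andbT ?andbF ?orbF.
    suff -> : (u \in J) = false by rewrite andbT.
    by apply: contraTF uL => /JR; rewrite right_partE.
  suff -> : (u \in I) = false by [].
  by apply: contraNF uL => /IL.
split=> [cut0 I J IL JR conS|cut0 S conS conS'].
  rewrite compl // => conS'; rewrite -subr_ge0 -bipartite_cut_slack //.
  exact: cut0.
have defS : S = (S :&: L) :|: (S :&: R).
  apply/setP=> u; rewrite in_setU !in_setI right_partE -andb_orr.
  by rewrite orbN andbT.
have SL : S :&: L \subset L by apply: subsetIr.
have SR : S :&: R \subset R by apply: subsetIr.
rewrite defS bipartite_cut_slack // subr_ge0; apply: cut0 => //.
  by rewrite -defS.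
by rewrite compl // -defS.
Qed.

End Bipartite.

(** * Bounded integral decompositions from feasible flows *)

Theorem theorem4p3 (n r : nat) (hr : (r <= n)%N) (G : rel 'I_n)
  (simpleG : simple_graph G)
  (bipG : has_bipartition G (left_part n r) (right_part n r))
  (connG : connected_graph G)
  (s : 'I_n -> int) (a b : {set 'I_n} -> int)
  (leab : forall e : {set 'I_n}, e \in edges G -> a e <= b e) :
  (exists x : {set 'I_n} -> int,
     (forall e : {set 'I_n}, e \in edges G -> a e <= x e /\ x e <= b e) /\
     \sum_(i < n) s i *: std_basis i = \sum_(e in edges G) x e *: edge_vec e)
  <->
  (\sum_(i in left_part n r) s i = \sum_(j in right_part n r) s j /\
   forall I J : {set 'I_n},
     I \subset left_part n r -> J \subset right_part n r ->
     connected_on G (I :|: J) ->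
     connected_on G ((left_part n r :\: I) :|: (right_part n r :\: J)) ->
     \sum_(i in I) s i - \sum_(j in J) s j
     <= \sum_(i in I) \sum_(j in right_part n r :\: J | G i j) b [set i; j]
        - \sum_(i in left_part n r :\: I) \sum_(j in J | G i j) a [set i; j]).
Proof.
have [symG _] := simpleG.
have edgeG u w : G u w -> [set u; w] \in edges G.
  by move=> Guw; apply/imset2P; exists u w; rewrite ?inE.
rewrite -(bipartite_cut_slackP G s a b simpleG bipG).
have sum0E : \sum_(i in left_part n r) s i = \sum_(j in right_part n r) s j
    <-> \sum_u signed (r := r) s u = 0.
  rewrite sum_signed; split=> [->|/eqP]; first by rewrite subrr.
  by rewrite subr_eq0 => /eqP.
rewrite sum0E; split.
  case=> x [xab /(std_decompositionP _ _ _ _ simpleG) sx].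
  have flow : skew_flow (orient (r := r) G b a) (orient (r := r) G x x).
    split=> u w; first exact: orient_swap.
    rewrite /orient; case: ifP => // /edgeG/xab[].
    by case: ifP; rewrite // lerN2.
  have out u : \sum_w orient (r := r) G x x u w = signed (r := r) s u.
    by rewrite sum_orient -sx.
  split; first exact: skew_flow_sum flow out.
  by move=> S _ _; apply: skew_flow_cut flow out.
case=> sum0 conn_ge0.
(* On an edge the two opposite capacities add up to [b - a]. *)
have k0 u w : 0 <= orient (r := r) G b a u w + orient (r := r) G b a w u.
  rewrite [X in _ + X](orient_swap _ simpleG bipG) subr_ge0 /orient.
  by case: ifP => // /edgeG/leab; case: ifP; rewrite // lerN2.
have kG u w : ~~ G u w -> orient (r := r) G b a u w = 0.
  by rewrite /orient => /negbTE->.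
have [y [[sk yk] yd]] := hoffman_circulation _ _ k0 sum0
  (cut_slack_connected G symG _ _ connG kG sum0 conn_ge0).
(* An edge meets each side in one vertex, so for an edge this sum has one term. *)
pose x (e : {set 'I_n}) := \sum_(i in e :&: left_part n r)
  \sum_(j in e :&: right_part n r) y i j.
have xE u w : u \in left_part n r -> G u w -> x [set u; w] = y u w.
  move=> uL Guw; have wL := adj_left G bipG _ _ Guw; rewrite uL /= in wL.
  have eL : [set u; w] :&: left_part n r = [set u].
    apply/setP=> v; rewrite in_setI in_set2 in_set1.
    have [->|_] := eqVneq v u; first by rewrite uL.
    by have [->|] := eqVneq v w.
  have eR : [set u; w] :&: right_part n r = [set w].
    apply/setP=> v; rewrite in_setI in_set2 in_set1 right_partE.
    have [->|_] := eqVneq v w; first by rewrite wL orbT.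
    by have [->|] := eqVneq v u; rewrite ?uL.
  by rewrite /x eL eR !big_set1.
(* Off the edges both capacities are 0, so skew symmetry forces [y u w = 0]. *)
have yE u w : y u w = orient (r := r) G x x u w.
  have [Guw|nGuw] := boolP (G u w); last first.
    rewrite /orient (negbTE nGuw); have := yk u w; have := yk w u.
    have nGwu : ~~ G w u by rewrite symG.
    by rewrite (sk w u) (kG u w nGuw) (kG w u nGwu) => ? ?; lia.
  have [uL|uL] := boolP (u \in left_part n r).
    by rewrite orient_left // xE.
  rewrite orient_right // setUC xE ?(adj_left G bipG _ _ Guw) 1?symG //.
exists x; split.
  move=> e /imset2P[i j _]; rewrite inE => /andP[_ Gij] ->.
  wlog iL : i j Gij / i \in left_part n r => [wl|].
    have [iL|iL] := boolP (i \in left_part n r); first exact: wl.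
    by rewrite setUC; apply: wl; rewrite 1?symG // (adj_left G bipG _ _ Gij).
  have Gji : G j i by rewrite symG.
  have jL : j \notin left_part n r by rewrite (adj_left G bipG _ _ Gij) iL.
  (* The arc from [i] to [j] yields the upper bound and its reverse the lower bound. *)
  have := yk i j; have := yk j i; rewrite (sk j i) orient_right // orient_left //.
  by rewrite lerN2 xE // setUC.
apply/(std_decompositionP _ _ _ _ simpleG) => v.
have := yd v; under eq_bigr do rewrite yE.
by rewrite sum_orient /signed; case: ifP => // _ /oppr_inj.
Qed.
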